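(* Let $\mathcal{T} \subseteq \mathcal{F}$ be a chain of sets. Then the following statements are logically equivalent. 1. $\mathcal{T}_* \subseteq \mathcal{F}$ and for any $\mathcal{C} \subseteq \mathcal{T}$, $\nu(\bigcup \mathcal{C}) = \sup_{C \in \mathcal{C}} \nu(C)$ and $\nu(\bigcap \mathcal{C}) = \inf_{C \in \mathcal{C}} \nu(C)$. 2. There exists a chain $\mathcal{U} \subseteq \mathcal{F}$ such that $\mathcal{T} \subseteq \mathcal{U}$ and $\nu(\mathcal{U}) := \{ \nu(A) : A \in \mathcal{U} \}$ is dense in $[0,1]$. 3. For every $\epsilon > 0$ there exists $N_{\epsilon} \in \mathbb{N}$ such that $\lvert \nu_N(A) - \nu(A) \rvert < \epsilon$ for all $A \in \mathcal{T}$ and all $N > N_{\epsilon}$. Moreover, if any of the three statements holds then, for any chain $\mathcal{U}$ as in statement 2: (i) $\mathcal{U}_* \subseteq \mathcal{F}$ and for any $\mathcal{C} \subseteq \mathcal{U}_*$, $\nu(\bigcup \mathcal{C}) = \sup_{C \in \mathcal{C}} \nu(C)$ and $\nu(\bigcap \mathcal{C}) = \inf_{C \in \mathcal{C}} \nu(C)$; (ii) $\nu(\mathcal{U}_* ) = [0,1]$; (iii) for every $\epsilon > 0$ there exists $N_{\epsilon} \in \mathbb{N}$ such that $\lvert \nu_N(A) - \nu(A) \rvert < \epsilon$ for all $A \in \mathcal{U}_*$ and all $N > N_{\epsilon}$.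
   Context: $\mathbb{N} = \{1,2,3,\ldots\}$. For $A \subseteq \mathbb{N}$ and $N \in \mathbb{N}$ let $\nu_N(A) := \frac{1}{N}\sum_{n=1}^N I_A(n)$, where $I_A$ is the indicator function of $A$. $\mathcal{F}$ is the collection of all $A \subseteq \mathbb{N}$ for which $\nu(A) := \lim_{N\to\infty} \nu_N(A)$ exists. A chain is a collection of subsets of $\mathbb{N}$ totally ordered by inclusion. For a chain $\mathcal{T}$ of subsets of $\mathbb{N}$, $\mathcal{T}_{\cup} := \{\bigcup \mathcal{C} : \mathcal{C} \subseteq \mathcal{T}\}$, $\mathcal{T}_{\cap} := \{\bigcap \mathcal{C} : \mathcal{C} \subseteq \mathcal{T}\}$ and $\mathcal{T}_* := \mathcal{T}_{\cup} \cup \mathcal{T}_{\cap}$. For the empty subfamily: $\bigcup \emptyset = \emptyset$, $\bigcap \emptyset = \mathbb{N}$, and suprema and infima are taken in $[0,1]$ (so $\sup\emptyset = 0$, $\inf \emptyset = 1$). *)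

(* Defs.v *)
From mathcomp Require Import all_boot all_order all_algebra.
From mathcomp Require Import all_classical all_reals all_analysis.
Import numFieldNormedType.Exports.

Set Implicit Arguments.
Unset Strict Implicit.
Unset Printing Implicit Defensive.

Import Order.TTheory GRing.Theory Num.Theory.

Local Open Scope classical_set_scope.
Local Open Scope ring_scope.

(* The natural numbers {1, 2, 3, ...}: a type of its own, so that the empty
   intersection [setT] and the density averages do not involve 0. *)
Definition posnat := {n : nat | (0 < n)%N}.

Definition pos_succ (n : nat) : posnat := exist _ n.+1 (ltn0Sn n).

(* [pos_succ n], for n < N, runs through 1, ..., N. At N = 0 the value is the
   junk 0, which has no influence on limits. *)
Definition nuN (R : realType) (N : nat) (A : set posnat) : R :=
  N%:R^-1 * \sum_(n < N) \1_A (pos_succ n).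

Definition has_nu (R : realType) : set (set posnat) :=
  [set A | cvgn (fun N => nuN R N A)].

(* Meaningful only on [has_nu R]. *)
Definition nu (R : realType) (A : set posnat) : R :=
  limn (fun N => nuN R N A).

Definition chain (T : set (set posnat)) : Prop := total_on T subset.

Definition Tcup (T : set (set posnat)) : set (set posnat) :=
  [set \bigcup_(A in C) A | C in [set C | C `<=` T]].

Definition Tcap (T : set (set posnat)) : set (set posnat) :=
  [set \bigcap_(A in C) A | C in [set C | C `<=` T]].

Definition Tstar (T : set (set posnat)) : set (set posnat) :=
  Tcup T `|` Tcap T.

(* Suprema and infima are those of [0, 1]: the first argument of [supremum] and
   [infimum] is the value on the empty set. The equations include the existence
   of the densities on their left-hand sides. *)
Definition nu_sup_inf (R : realType) (S : set (set posnat)) : Prop :=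
  forall C : set (set posnat), C `<=` S ->
    (has_nu R (\bigcup_(A in C) A) /\
     nu R (\bigcup_(A in C) A) = supremum 0 (nu R @` C)) /\
    (has_nu R (\bigcap_(A in C) A) /\
     nu R (\bigcap_(A in C) A) = infimum 1 (nu R @` C)).

Definition dense_chain_extension (R : realType) (T U : set (set posnat)) :
    Prop :=
  [/\ chain U, U `<=` has_nu R, T `<=` U &
      `[0, 1]%classic `<=` closure (nu R @` U)].

Definition nu_uniform (R : realType) (S : set (set posnat)) : Prop :=
  forall eps : R, 0 < eps -> exists2 Neps : nat, (0 < Neps)%N &
    forall A, S A -> forall N : nat, (Neps < N)%N ->
      `| nuN R N A - nu R A | < eps.

(* Main.v *)
Require Import Defs.
From mathcomp Require Import all_boot all_order all_algebra.
From mathcomp Require Import all_classical all_reals all_analysis.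
From mathcomp Require Import ring lra.
Import numFieldNormedType.Exports.
Import Order.TTheory GRing.Theory Num.Theory.

Local Open Scope classical_set_scope.
Local Open Scope ring_scope.

(** The three statements are proved equivalent in the cycle 2 => 3 => 1 => 2.

    2 => 3 ([dense_uniform]).  In a chain, a set of smaller density is a subset
    of any set of larger density.  Density of the values provides finitely many
    members of the chain whose densities form a fine net of [0, 1].  They have a
    common rate of convergence, and every other member is squeezed between two
    neighbours of the net, hence inherits this rate up to the mesh.

    3 => 1 ([uniform_sup_inf]).  Up to a given N a nonempty union of members of
    a chain agrees with one of these members, so its N-th average is within
    epsilon of the density of that member as soon as N is past the uniform
    rank.  This bounds the averages of the union by the supremum plus epsilon;
    the lower bound is monotonicity.  Intersections follow by passing to
    complements, which turn chains into chains and nu into 1 - nu.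

    1 => 2 ([Tstar_gap_closed], [gap_closed_add], [gap_closed_dense]).  By
    statement 1, cutting T at a level q gives two members L and G of T_*, the
    union of the sets of density below q and the intersection of the others,
    with nu L <= q <= nu G and no member of T_* strictly between them.  A set B
    of density exactly q with L <= B <= G can be built directly
    ([between_density]), and T_* together with B still has a pair of consecutive
    members around every level.  So rational levels can be inserted one after
    the other, and the union of the resulting increasing sequence of chains is
    a chain with a dense set of densities.

    For the last part, a chain U as in statement 2 is uniform, hence satisfies
    statement 1, so U_* is a chain of sets with a density; it contains U and
    therefore is again as in statement 2, and the same implications apply to it.
    A level x of [0, 1] is the density of the union of the members of U of
    density below x. *)

Section DensityChains.
Set Implicit Arguments.
Unset Strict Implicit.
Unset Printing Implicit Defensive.
Context {R : realType}.
Implicit Types (A B L G : set posnat) (S T U : set (set posnat)) (N : nat).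

(** * Averages and densities *)

Lemma has_nu_cvg A : has_nu R A -> nuN R N A @[N --> \oo] --> nu R A.
Proof. by []. Qed.

Lemma cvg_has_nu A (s : R) :
  nuN R N A @[N --> \oo] --> s -> has_nu R A /\ nu R A = s.
Proof.
move=> h; split; first by apply/cvg_ex; exists s.
exact/cvg_lim.
Qed.

Lemma nuN_ge0 N A : 0 <= nuN R N A.
Proof. by rewrite mulr_ge0 ?invr_ge0 // sumr_ge0. Qed.

Lemma nuN_le N A B : A `<=` B -> nuN R N A <= nuN R N B.
Proof.
move=> AB; rewrite ler_wpM2l ?invr_ge0 //; apply: ler_sum => i _.
rewrite !indicE ler_nat; case: (boolP (_ \in A)) => // /set_mem/AB.
by move=> /mem_set ->.
Qed.

Lemma nuN_setC N A : (0 < N)%N -> nuN R N (~` A) = 1 - nuN R N A.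
Proof.
move=> N0; have N0R : N%:R != 0 :> R by rewrite pnatr_eq0 -lt0n.
rewrite /nuN [X in X - _ * _](_ : 1 = N%:R^-1 * N%:R); last by rewrite mulVf.
rewrite -mulrBr; congr (_ * _).
rewrite -[X in X%:R - _]card_ord -sumr_const -sumrB; apply: eq_bigr => i _.
rewrite indicC indicE; case: (_ \in _); by rewrite ?subrr ?subr0.
Qed.

Lemma nuN_le1 N A : nuN R N A <= 1.
Proof.
case: (posnP N) => [->|N0]; first by rewrite /nuN big_ord0 mulr0.
by rewrite -subr_ge0 -nuN_setC // nuN_ge0.
Qed.

Lemma eq_nuN N A B :
  (forall i : 'I_N, A (pos_succ i) <-> B (pos_succ i)) -> nuN R N A = nuN R N B.
Proof.
move=> AB; congr (_ * _); apply: eq_bigr => i _; rewrite !indicE.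
by congr (_%:R); congr (nat_of_bool _); apply/idP/idP => /set_mem /AB /mem_set.
Qed.

Lemma nu_le A B : has_nu R A -> has_nu R B -> A `<=` B -> nu R A <= nu R B.
Proof.
by move=> hA hB AB; apply: ler_lim => //; apply: nearW => N; exact: nuN_le.
Qed.

Lemma nu_itv A : has_nu R A -> 0 <= nu R A <= 1.
Proof.
move=> hA; apply/andP; split.
  by apply: limr_ge => //; apply: nearW => N; exact: nuN_ge0.
by apply: limr_le => //; apply: nearW => N; exact: nuN_le1.
Qed.

Lemma cvg_nuN_setC A (s : R) :
  nuN R N A @[N --> \oo] --> s -> nuN R N (~` A) @[N --> \oo] --> 1 - s.
Proof.
move=> As; have : (1 - nuN R N A) @[N --> \oo] --> 1 - s.
  by apply: cvgB => //; exact: cvg_cst.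
apply: cvg_trans; apply: near_eq_cvg; near=> N.
by rewrite nuN_setC //; near: N; exact: nbhs_infty_gt.
Unshelve. all: by end_near. Qed.

Lemma nu_setC A : has_nu R A -> has_nu R (~` A) /\ nu R (~` A) = 1 - nu R A.
Proof. by move=> /has_nu_cvg/cvg_nuN_setC/cvg_has_nu. Qed.

(** * Chains *)

Lemma chain_lt T A B : T `<=` has_nu R -> chain T -> T A -> T B ->
  nu R A < nu R B -> A `<=` B.
Proof.
move=> TF Tc TA TB AB; have [//|BA] := Tc _ _ TA TB.
by have := nu_le (TF _ TB) (TF _ TA) BA; rewrite leNgt AB.
Qed.

Lemma chain_setC T : chain T -> chain (setC @` T).
Proof.
by move=> Tc _ _ [A TA <-] [B TB <-]; case: (Tc _ _ TA TB) => h; [right|left];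
  exact: subsetC.
Qed.

Lemma bigcap_setC (C : set (set posnat)) :
  \bigcap_(A in C) A = ~` \bigcup_(A in setC @` C) A.
Proof.
rewrite bigcup_image setC_bigcup; apply: eq_bigcapr => A _; exact: esym (setCK _).
Qed.

(** If a union or intersection is not included in another one, this is witnessed by
    a single member (or by a pair of members, for a union against an
    intersection), and comparing the witness with all other members gives the
    reverse inclusion. *)
Lemma chain_Tstar T : chain T -> chain (Tstar T).
Proof.
move=> Tc.
have cupcup C D : C `<=` T -> D `<=` T ->
    \bigcup_(A in C) A `<=` \bigcup_(A in D) A \/
    \bigcup_(A in D) A `<=` \bigcup_(A in C) A.
  move=> CT DT.
  have [h|] := pselect (forall A, C A -> A `<=` \bigcup_(A in D) A).
    by left; apply: bigcup_sub.
  move=> /existsNP[A /not_implyP[CA AD]]; right.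
  have DA B : D B -> B `<=` A.
    move=> DB; have [AB|//] := Tc _ _ (CT _ CA) (DT _ DB).
    by case: AD; apply: subset_trans AB _; exact: bigcup_sup.
  by apply: subset_trans (bigcup_sub DA) _; exact: bigcup_sup.
have capcap C D : C `<=` T -> D `<=` T ->
    \bigcap_(A in C) A `<=` \bigcap_(A in D) A \/
    \bigcap_(A in D) A `<=` \bigcap_(A in C) A.
  move=> CT DT.
  have [h|] := pselect (forall B, D B -> \bigcap_(A in C) A `<=` B).
    by left; apply: sub_bigcap.
  move=> /existsNP[B /not_implyP[DB CB]]; right.
  have BC A : C A -> B `<=` A.
    move=> CA; have [AB|//] := Tc _ _ (CT _ CA) (DT _ DB).
    by case: CB; apply: subset_trans AB; exact: bigcap_inf.
  by apply: subset_trans (sub_bigcap BC); exact: bigcap_inf.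
have cupcap C D : C `<=` T -> D `<=` T ->
    \bigcup_(A in C) A `<=` \bigcap_(A in D) A \/
    \bigcap_(A in D) A `<=` \bigcup_(A in C) A.
  move=> CT DT.
  have [h|] := pselect (forall A B, C A -> D B -> A `<=` B).
    by left; apply: bigcup_sub => A CA; apply: sub_bigcap => B DB; exact: h.
  move=> /existsNP[A /existsNP[B /not_implyP[CA /not_implyP[DB AB]]]]; right.
  have [//|BA] := Tc _ _ (CT _ CA) (DT _ DB).
  by move=> x Dx; exists A => //; exact: BA (Dx _ DB).
move=> _ _ [[C CT <-]|[C CT <-]] [[D DT <-]|[D DT <-]].
- exact: cupcup.
- exact: cupcap.
- by apply/or_comm/cupcap.
- exact: capcap.
Qed.

Lemma sub_Tstar T : T `<=` Tstar T.
Proof.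
by move=> A TA; left; exists [set A]; [move=> _ ->|exact: bigcup_set1].
Qed.

(** * Suprema and infima in [0, 1] *)

(** The supremum relative to the interval [0, 1], by approximation from below.
    Restricting the approximated levels to [r >= 0] makes 0 the supremum of the
    empty set without a special case. *)
Definition is_sup01 (s : R) (X : set R) :=
  [/\ 0 <= s, (forall x, X x -> x <= s) &
      forall r, 0 <= r < s -> exists2 x, X x & r < x].

Lemma is_sup01_supremum (X : set R) :
  (forall x, X x -> 0 <= x <= 1) -> is_sup01 (supremum 0 X) X.
Proof.
move=> X01; case: (eqVneq X set0) => [->|/set0P[x0 Xx0]].
  rewrite supremum0; split => // r /andP[r0 /(le_lt_trans r0)].
  by rewrite ltxx.
have hX : has_sup X by split; [exists x0 | exists 1 => x /X01/andP[]].
split.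
- apply: le_trans (sup_upper_bound hX Xx0).
  by have /andP[] := X01 _ Xx0.
- by move=> x; exact: sup_upper_bound.
- move=> r /andP[_ rs]; have e0 : 0 < sup X - r by rewrite subr_gt0.
  by have [x Xx] := sup_adherent e0 hX; rewrite subKr; exists x.
Qed.

Lemma infimum_inf (X : set R) : has_inf X -> infimum 1 X = inf X.
Proof.
move=> hX; have X0 : X !=set0 by case: hX.
rewrite /infimum ifF; last by apply/negbTE/set0P.
apply: xget_subset1; last exact: is_subset1_infimums.
split; first exact/ge_inf/(proj2 hX).
by move=> x; exact: lb_le_inf.
Qed.

(** Stated through [1 - x] to match the passage to complements, which changes
    densities in this way. *)
Lemma is_sup01_infimum (X : set R) :
  (forall x, X x -> 0 <= x <= 1) ->
  is_sup01 (1 - infimum 1 X) [set 1 - x | x in X].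
Proof.
move=> X01; case: (eqVneq X set0) => [->|/set0P[x0 Xx0]].
  rewrite /infimum eqxx subrr image_set0; split => // r /andP[r0 /(le_lt_trans r0)].
  by rewrite ltxx.
have hX : has_inf X by split; [exists x0 | exists 0 => x /X01/andP[]].
rewrite infimum_inf //; split.
- rewrite subr_ge0; apply: le_trans (ge_inf (proj2 hX) Xx0) _.
  by have /andP[] := X01 _ Xx0.
- by move=> _ [x Xx <-]; rewrite lerD2l lerN2; exact: ge_inf (proj2 hX) _ Xx.
- move=> r /andP[_ rs]; have e0 : 0 < 1 - r - inf X by lra.
  have [x Xx xr] := inf_adherent e0 hX; exists (1 - x); first by exists x.
  lra.
Qed.

(** * Uniform convergence gives continuity along unions and intersections *)

Lemma nu_uniformP S : nu_uniform R S <-> forall eps : R, 0 < eps ->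
  \forall N \near \oo, forall A, S A -> `|nuN R N A - nu R A| < eps.
Proof.
split=> h e /h.
  move=> [M M0 hM]; exists M.+1 => // N /= MN A SA; exact: hM.
move=> [M _ hM]; exists M.+1 => // A SA N MN; apply: hM => //=.
exact: ltnW (ltnW MN).
Qed.

Lemma nu_uniform_sub S T : S `<=` T -> nu_uniform R T -> nu_uniform R S.
Proof.
move=> ST uT e /uT[M M0 hM]; exists M => // A SA; exact/hM/ST.
Qed.

Lemma nu_uniform_setC S : S `<=` has_nu R ->
  nu_uniform R S -> nu_uniform R (setC @` S).
Proof.
move=> SF /nu_uniformP uS; apply/nu_uniformP => e /uS; apply: filter_app.
near=> N => h _ [A SA <-]; have [_ ->] := nu_setC (SF _ SA).
rewrite nuN_setC; last by near: N; exact: nbhs_infty_gt.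
have -> : 1 - nuN R N A - (1 - nu R A) = - (nuN R N A - nu R A) by ring.
by rewrite normrN h.
Unshelve. all: by end_near. Qed.

(** Each of the points 1, ..., N of the union lies in some member, and the largest
    of these finitely many members contains them all. *)
Lemma bigcup_chain_initial {T} C N : chain T -> C `<=` T -> C !=set0 ->
  exists2 A, C A & forall i : 'I_N, (\bigcup_(A in C) A) (pos_succ i) <-> A (pos_succ i).
Proof.
move=> Tc CT [A0 CA0].
suff [A CA hA] : exists2 A, C A &
    forall i, (i < N)%N -> (\bigcup_(A in C) A) (pos_succ i) -> A (pos_succ i).
  by exists A => // i; split => [/hA|Ai]; [apply|exists A].
elim: N => [|N [A CA hA]]; first by exists A0.
have [[B CB BN]|h] := pselect ((\bigcup_(A in C) A) (pos_succ N)); last first.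
  exists A => // i; rewrite ltnS leq_eqVlt => /predU1P[-> //|]; exact: hA.
have [AB|BA] := Tc _ _ (CT _ CA) (CT _ CB).
  exists B => // i; rewrite ltnS leq_eqVlt => /predU1P[-> //|iN Ci].
  exact/AB/hA.
exists A => // i; rewrite ltnS leq_eqVlt => /predU1P[-> _|]; [exact: BA|exact: hA].
Qed.

(** Uniformity is what makes the approximating member, which depends on [N],
    harmless: the rank past which it is close to its density does not. *)
Lemma uniform_bigcup T C s : T `<=` has_nu R -> chain T -> nu_uniform R T ->
  C `<=` T -> is_sup01 s (nu R @` C) ->
  nuN R N (\bigcup_(A in C) A) @[N --> \oo] --> s.
Proof.
move=> TF Tc /nu_uniformP uT CT [s0 sub slub]; apply/cvgrPdist_lt => e e0.
have e20 : 0 < e / 2 by lra.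
have lower : \forall N \near \oo, s - e < nuN R N (\bigcup_(A in C) A).
  have [se|se] := ltP (s - e / 2) 0.
    (* There is no level of [0, 1] to approximate from below. *)
    by apply: nearW => N; have := nuN_ge0 N (\bigcup_(A in C) A); lra.
  have [|_ [A CA <-] sA] := slub (s - e / 2); first by rewrite se /=; lra.
  apply: filterS (uT _ e20) => N /(_ _ (CT _ CA)).
  have : nuN R N A <= nuN R N (\bigcup_(A in C) A).
    by apply: nuN_le; exact: bigcup_sup.
  by rewrite ltr_norml; lra.
have upper : \forall N \near \oo, nuN R N (\bigcup_(A in C) A) < s + e.
  apply: filterS (uT _ e0) => N hN.
  have [->|/set0P C0] := eqVneq C set0.
    rewrite bigcup_set0 /nuN big1 ?mulr0; first lra.
    by move=> i _; rewrite indic0.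
  have [A CA /eq_nuN ->] := bigcup_chain_initial N Tc CT C0.
  have := hN _ (CT _ CA); have := sub _ (imageP _ CA).
  by rewrite ltr_norml; lra.
near=> N; rewrite ltr_norml.
have : s - e < nuN R N (\bigcup_(A in C) A) by near: N.
have : nuN R N (\bigcup_(A in C) A) < s + e by near: N.
lra.
Unshelve. all: by end_near. Qed.

Lemma uniform_sup_inf T : T `<=` has_nu R -> chain T -> nu_uniform R T ->
  nu_sup_inf R T.
Proof.
move=> TF Tc uT C CT.
have C01 x : (nu R @` C) x -> 0 <= x <= 1.
  by move=> [A CA <-]; apply/nu_itv/TF/CT.
split; apply: cvg_has_nu.
  by apply: (uniform_bigcup TF) => //; exact: is_sup01_supremum.
rewrite bigcap_setC -[infimum _ _](subKr 1); apply: cvg_nuN_setC.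
apply: (@uniform_bigcup (setC @` T)).
- by move=> _ [A TA <-]; have [] := nu_setC (TF _ TA).
- exact: chain_setC.
- exact: nu_uniform_setC.
- exact: image_subset.
- have -> : nu R @` (setC @` C) = [set 1 - x | x in nu R @` C].
    rewrite !image_comp; apply: eq_imagel => A CA /=.
    by have [] := nu_setC (TF _ (CT _ CA)).
  exact: is_sup01_infimum.
Qed.

Lemma Tstar_has_nu T : nu_sup_inf R T -> Tstar T `<=` has_nu R.
Proof. by move=> h _ [[C /h[[]] ? _ _ <-]|[C /h[_ []] ? _ <-]]. Qed.

(** * A dense chain converges uniformly *)

Definition nu_dense U := forall x y : R, 0 <= x -> x < y -> y <= 1 ->
  exists2 A, U A & x < nu R A < y.

Lemma nu_denseP U : `[0, 1]%classic `<=` closure (nu R @` U) <-> nu_dense U.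
Proof.
split=> h.
  move=> x y x0 xy y1.
  have /h : ((x + y) / 2 : R) \in `[0, 1]%R by rewrite in_itv /=; lra.
  move=> /(_ `]x, y[%classic) []; first by apply: near_in_itvoo; rewrite in_itv/=; lra.
  by move=> _ [[A UA <-]]; rewrite /= in_itv /= => ?; exists A.
move=> z /=; rewrite in_itv /= => /andP[z0 z1] B /nbhs_ballP[e /= e0 eB].
have [|||A UA /andP[]] := h (Num.max 0 (z - e)) (Num.min 1 (z + e)).
- by rewrite le_max lexx.
- by rewrite lt_min !gt_max; apply/andP; split; apply/andP; split; lra.
- by rewrite ge_min lexx.
rewrite gt_max lt_min => /andP[_ zA] /andP[_ Az].
exists (nu R A); split; first exact: imageP.
by apply: eB; rewrite /ball /= ltr_distl; lra.
Qed.

Lemma nu_dense_setC U : U `<=` has_nu R -> nu_dense U -> nu_dense (setC @` U).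
Proof.
move=> UF Ud x y x0 xy y1.
have [|||A UA hA] := Ud (1 - y) (1 - x); [lra..|].
exists (~` A); first exact: imageP.
by have [_ ->] := nu_setC (UF _ UA); lra.
Qed.

(** Half of the sandwich argument: a member of [U] lies inside the next but one
    element of a finite net.  The other half is this one for complements. *)
Lemma dense_upper U : U `<=` has_nu R -> chain U -> nu_dense U ->
  forall eps : R, 0 < eps ->
  \forall N \near \oo, forall A, U A -> nuN R N A < nu R A + eps.
Proof.
move=> UF Uc Ud e e0.
(* The error is at most three steps of the net: the net element lies less than
   two steps above [nu A], and its own average is within one step. *)
pose m := (Num.truncn (3 / e)).+1.
have mR : 0 < m%:R :> R by rewrite ltr0n.
have me : 3 / m%:R < e.
  by rewrite ltr_pdivrMr // mulrC -ltr_pdivrMr //; exact: truncnS_gt.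
have hA (i : 'I_m) : exists A, U A /\ i%:R / m%:R < nu R A < i.+1%:R / m%:R.
  have [|||A UA] := Ud (i%:R / m%:R) (i.+1%:R / m%:R); last by exists A.
  - by rewrite divr_ge0.
  - by rewrite ltr_pM2r ?invr_gt0 // ltr_nat.
  - by rewrite ler_pdivrMr // mul1r ler_nat.
have [F hF] := choice hA.
have net : \forall N \near \oo, forall i, nuN R N (F i) < nu R (F i) + 1 / m%:R.
  apply: filter_forall => i; have [/UF/has_nu_cvg /cvgrPdist_lt + _] := hF i.
  move=> /(_ (1 / m%:R)) h; have /h : 0 < 1 / m%:R :> R by rewrite divr_gt0.
  by apply: filterS => N; rewrite ltr_norml; lra.
apply: filterS net => N hN A UA.
have /andP[a0 a1] := nu_itv (UF _ UA).
have am0 : 0 <= nu R A * m%:R by rewrite mulr_ge0 // ltW.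
have /andP[ia ai] := truncn_itv am0; set i := Num.truncn _ in ia ai.
have {}ia : i%:R / m%:R <= nu R A by rewrite ler_pdivrMr.
have {}ai : nu R A < i.+1%:R / m%:R by rewrite ltr_pdivlMr.
have iS k : k.+1%:R / m%:R = k%:R / m%:R + 1 / m%:R :> R.
  by rewrite -natr1 mulrDl.
have [im|im] := ltnP i.+1 m.
  have [UF' /andP[Fl Fu]] := hF (Ordinal im).
  have AF : A `<=` F (Ordinal im).
    by apply: (chain_lt UF) => //; apply: lt_trans Fl.
  have := nuN_le N AF; have := hN (Ordinal im); move: Fu => /=.
  by rewrite !iS; lra.
(* No net element is left above [A], but then [nu A] is close to 1. *)
have : 1 <= i.+1%:R / m%:R :> R by rewrite ler_pdivlMr // mul1r ler_nat.
have := nuN_le1 N A; rewrite iS.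
have : 0 < 1 / m%:R :> R by rewrite divr_gt0.
lra.
Qed.

Lemma dense_uniform U : U `<=` has_nu R -> chain U -> nu_dense U ->
  nu_uniform R U.
Proof.
move=> UF Uc Ud; apply/nu_uniformP => e e0.
have UF' : setC @` U `<=` has_nu R.
  by move=> _ [A UA <-]; have [] := nu_setC (UF _ UA).
have up := dense_upper UF Uc Ud e0.
have dn := dense_upper UF' (chain_setC Uc) (nu_dense_setC UF Ud) e0.
near=> N => A UA.
have hu : nuN R N A < nu R A + e by apply: (near up N) => //.
have : nuN R N (~` A) < nu R (~` A) + e by apply: (near dn N) => //; exact: imageP.
have [_ ->] := nu_setC (UF _ UA).
rewrite nuN_setC; last by near: N; exact: nbhs_infty_gt.
by rewrite ltr_norml; lra.
Unshelve. all: by end_near. Qed.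

(** * Interpolating a density *)

(** The set whose counting function is [f], when [f] starts at 0 and has
    increments 0 or 1. *)
Definition jumps (f : nat -> nat) : set posnat :=
  [set m | (f (val m).-1 < f (val m))%N].

Lemma pos_succ_pred (m : posnat) : m = pos_succ (val m).-1.
Proof. by apply: val_inj; rewrite /= prednK // (valP m). Qed.

Lemma nuN_jumps f N : f 0%N = 0%N -> (forall n, (f n <= f n.+1 <= (f n).+1)%N) ->
  nuN R N (jumps f) = N%:R^-1 * (f N)%:R.
Proof.
move=> f0 fS; congr (_ * _); elim: N => [|N IH]; first by rewrite big_ord0 f0.
rewrite big_ord_recr /= IH indicE -natrD; congr _%:R.
have /andP[] := fS N; rewrite leq_eqVlt => /orP[/eqP e _|lt le].
  by rewrite memNset ?addn0 // /jumps /= -e ltnn.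
by rewrite mem_set // addn1; apply/eqP; rewrite eqn_leq lt le.
Qed.

(** Take a convex combination [g] of the counting functions of [L] and [G], with
    the coefficients that make the density [q], and let [B] be the set counted
    by the integer part of [g].  At a point of [L] the combination increases by
    exactly 1 and so does its integer part; outside [G] it does not move; in
    between it increases by [t <= 1]. *)
Lemma between_density L G (q : R) : L `<=` G -> has_nu R L -> has_nu R G ->
  nu R L <= q <= nu R G ->
  exists B, [/\ L `<=` B, B `<=` G & nuN R N B @[N --> \oo] --> q].
Proof.
move=> LG hL hG /andP[Lq qG].
have [t /andP[t0 t1] qE] :
    exists2 t : R, 0 <= t <= 1 & q = (1 - t) * nu R L + t * nu R G.
  have [eq|ne] := eqVneq (nu R L) (nu R G).
    by exists 0; [rewrite lexx ler01 | lra].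
  have d0 : 0 < nu R G - nu R L by rewrite subr_gt0 lt_neqAle ne (le_trans Lq).
  exists ((q - nu R L) / (nu R G - nu R L)).
    apply/andP; split; first by apply: divr_ge0; lra.
    by rewrite ler_pdivrMr //; lra.
  by field; rewrite gt_eqF.
pose s A N : R := \sum_(n < N) \1_A (pos_succ n).
have sS A N : s A N.+1 = s A N + \1_A (pos_succ N) by rewrite /s big_ord_recr.
have s0 A N : 0 <= s A N by exact: sumr_ge0.
pose g N : R := (1 - t) * s L N + t * s G N.
have g0 N : 0 <= g N by rewrite addr_ge0 // mulr_ge0 // subr_ge0.
have gS N : g N.+1 = g N + ((1 - t) * \1_L (pos_succ N) + t * \1_G (pos_succ N)).
  rewrite /g !sS; ring.
pose f N := Num.truncn (g N).
have f1 N : (Num.truncn (g N + 1)) = (f N).+1.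
  by rewrite addrC truncnD ?nnegrE ?rpred1 // truncn1 add1n.
exists (jumps f); split.
- move=> m Lm; have mE := pos_succ_pred m.
  rewrite mE /jumps /= {2}/f gS -mE !indicE !mem_set //; last exact: LG.
  by rewrite !mulr1 subrK f1.
- move=> m; have mE := pos_succ_pred m.
  apply: contraPP => Gm; rewrite mE /jumps /= {2}/f gS -mE !indicE.
  rewrite !memNset //; last by move=> /LG.
  by rewrite !mulr0 !addr0 ltnn.
have fS n : (f n <= f n.+1 <= (f n).+1)%N.
  rewrite -f1; have i01 A m : 0 <= (\1_A m : R) <= 1.
    by rewrite indicE; case: (_ \in _); rewrite ?lexx ler01.
  have /andP[L0 L1] := i01 L (pos_succ n); have /andP[G0 G1] := i01 G (pos_succ n).
  by apply/andP; split; apply: le_truncn; rewrite gS; nra.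
have f00 : f 0%N = 0%N by rewrite /f /g /s !big_ord0 !mulr0 addr0 truncn0.
have gq : N%:R^-1 * g N @[N --> \oo] --> q.
  rewrite qE; have -> : (fun N => N%:R^-1 * g N) =
      (fun N => (1 - t) * nuN R N L + t * nuN R N G).
    by apply/funext => N; rewrite /nuN /g /s; ring.
  by apply: cvgD; apply: cvgM => //; exact: cvg_cst.
have gq1 : N%:R^-1 * g N - N%:R^-1 @[N --> \oo] --> q.
  rewrite -[q]subr0; apply: cvgB => //; rewrite -cvg_shiftS; exact: cvg_harmonic.
apply: squeeze_cvgr gq1 gq; apply: nearW => N.
rewrite nuN_jumps //; have /andP[] := truncn_itv (g0 N); rewrite -/(f N) => fl fu.
have N0 : 0 <= N%:R^-1 :> R by rewrite invr_ge0.
rewrite ler_wpM2l // andbT -[X in _ - X]mulr1 -mulrBr ler_wpM2l // lerBlDr natr1.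
exact: ltW.
Qed.

(** * Filling the gaps of a chain *)

(** Every level [q] lies in a gap of the chain whose two ends belong to the chain;
    the ends may coincide.  This form of the invariant passes easily to the chain
    with one more set inserted in a gap: the new set splits the gap into two, and
    it is an end of both halves. *)
Definition gap_closed T := [/\ T `<=` has_nu R, chain T &
  forall q : R, 0 <= q <= 1 -> exists L G, [/\ [/\ T L, T G & L `<=` G],
    nu R L <= q <= nu R G & forall A, T A -> A `<=` L \/ G `<=` A]].

Lemma Tstar_gap_closed T : chain T -> nu_sup_inf R T -> T `<=` has_nu R ->
  gap_closed (Tstar T).
Proof.
move=> Tc Tsi TF; split; [exact: Tstar_has_nu|exact: chain_Tstar|].
move=> q /andP[q0 q1].
pose C := [set A | T A /\ nu R A < q]; pose D := [set A | T A /\ q <= nu R A].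
have CT : C `<=` T by move=> A [].
have DT : D `<=` T by move=> A [].
have cov A : T A -> C A \/ D A.
  by move=> TA; have [?|?] := ltP (nu R A) q; [left|right].
exists (\bigcup_(A in C) A), (\bigcap_(A in D) A); split.
- split; [by left; exists C|by right; exists D|].
  apply: bigcup_sub => A [TA Aq]; apply: sub_bigcap => B [TB qB].
  by apply: (chain_lt TF) => //; exact: lt_le_trans qB.
- have [[_ ->] _] := Tsi _ CT; have [_ [_ ->]] := Tsi _ DT.
  have X01 E : E `<=` T -> forall x, (nu R @` E) x -> 0 <= x <= 1.
    by move=> ET x [A EA <-]; apply/nu_itv/TF/ET.
  have [_ _ lubC] := is_sup01_supremum (X01 _ CT).
  have [_ _ lubD] := is_sup01_infimum (X01 _ DT).
  apply/andP; split; rewrite leNgt; apply/negP => h.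
    have [|_ [A [_ +] <-]] := lubC q; first by rewrite q0.
    by move=> /ltW; rewrite leNgt => /negP.
  have [|_ [_ [A [_ +] <-] <-]] := lubD (1 - q); first by rewrite subr_ge0 q1/=; lra.
  by lra.
- move=> _ [[E ET <-]|[E ET <-]].
    have [[A [EA DA]]|h] := pselect (exists A, E A /\ D A).
      by right=> x Dx; exists A => //; exact: Dx.
    left; apply: bigcup_sub => A EA; have [CA|DA] := cov _ (ET _ EA).
      exact: bigcup_sup.
    by case: h; exists A.
  have [[A [EA CA]]|h] := pselect (exists A, E A /\ C A).
    by left=> x Ex; exists A => //; exact: Ex.
  right; apply: sub_bigcap => A EA; have [CA|DA] := cov _ (ET _ EA).
    by case: h; exists A.
  exact: bigcap_inf.
Qed.

(** The set [B] of density [q] is put in the gap around [q].  In the new chain the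
    consecutive pair around another level [r] is the old one, unless [B] falls
    strictly inside it; then [B] replaces one of its ends, on the side told by
    comparing [r] with [q]. *)
Lemma gap_closed_add T (q : R) : gap_closed T -> 0 <= q <= 1 ->
  exists T', [/\ T `<=` T', gap_closed T' & exists2 B, T' B & nu R B = q].
Proof.
move=> [TF Tc Tgap] q01; have [L [G [[TL TG LG] LqG LGgap]]] := Tgap q q01.
have [B [LB BG /cvg_has_nu[hB Bq]]] := between_density LG (TF _ TL) (TF _ TG) LqG.
have Bcmp A : T A -> A `<=` B \/ B `<=` A.
  move=> /LGgap[AL|GA]; [left|right].
    exact: subset_trans AL LB.
  exact: subset_trans BG GA.
exists (B |` T); split; [exact: subsetUr| |by exists B => //; left].
split.
- by move=> A [->|/TF].
- move=> A A' [->|TA] [->|TA'].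
  + by left.
  + exact/or_comm/Bcmp.
  + exact: Bcmp.
  + exact: Tc.
- move=> r r01; have [L' [G' [[TL' TG' LG'] LrG' gap']]] := Tgap r r01.
  have BL : (B `<=` L' \/ G' `<=` B) \/ (L' `<=` B /\ B `<=` G').
    have [L'B|BL'] := Bcmp _ TL'; last by left; left.
    have [G'B|BG'] := Bcmp _ TG'; first by left; right.
    by right.
  case: BL => [cB|[L'B BG']].
    exists L', G'; split=> //; first by split=> //; right.
    by move=> A [->|/gap'].
  have [rq|qr] := leP r q.
    exists L', B; split; first by split=> //; [right|left].
      by rewrite Bq rq andbT; case/andP: LrG'.
    move=> A [->|/gap'[|GA]]; [by right|by left|].
    by right; exact: subset_trans BG' GA.
  exists B, G'; split; first by split=> //; [left|right].
    by rewrite Bq (ltW qr); case/andP: LrG'.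
  move=> A [->|/gap'[AL|]]; [by left| |by right].
  by left; exact: subset_trans AL L'B.
Qed.

(** The rationals of [0, 1] are inserted one at a time; being a chain of sets with
    a density passes to the union of an increasing sequence. *)
Lemma gap_closed_dense T : gap_closed T ->
  exists U, [/\ T `<=` U, U `<=` has_nu R, chain U & nu_dense U].
Proof.
move=> Tg.
(* An enumeration of the rationals of [0, 1], with junk indices sent to 0. *)
pose q n : R := let x := if unpickle n is Some r then ratr r else 0 in
  if 0 <= x <= 1 then x else 0.
have q01 n : 0 <= q n <= 1.
  by rewrite /q; case: ifP => // _; rewrite lexx ler01.
have step (x : nat * set (set posnat)) : exists V', gap_closed x.2 ->
    [/\ x.2 `<=` V', gap_closed V' & exists2 B, V' B & nu R B = q x.1].
  case: x => n V /=; have [Vg|nVg] := pselect (gap_closed V); last by exists V.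
  by have [V' ?] := gap_closed_add Vg (q01 n); exists V'.
have [F hF] := choice step.
pose V := fix V n := if n is k.+1 then F (k, V k) else T.
have Vg n : gap_closed (V n).
  by elim: n => // n /(hF (n, V n))[].
have VS n : V n `<=` V n.+1 by have [] := hF (n, V n) (Vg n).
have Vle m n : (m <= n)%N -> V m `<=` V n.
  elim: n => [|n IH]; first by rewrite leqn0 => /eqP ->.
  rewrite leq_eqVlt => /predU1P[-> //|/IH /subset_trans]; apply; exact: VS.
exists (\bigcup_n V n); split.
- exact: (bigcup_sup (i := 0%N)).
- by apply: bigcup_sub => n _; have [] := Vg n.
- move=> A B [m _ Am] [n _ Bn]; have [_ Vc _] := Vg (maxn m n).
  apply: Vc; [apply: Vle Am; exact: leq_maxl|apply: Vle Bn; exact: leq_maxr].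
- move=> x y x0 xy y1; have [r] := rat_in_itvoo xy.
  rewrite in_itv /= => /andP[xr ry].
  have qr : q (pickle r) = ratr r by rewrite /q pickleK ifT //; lra.
  have [_ _ [B VB Bq]] := hF (pickle r, V (pickle r)) (Vg _).
  exists B; first by exists (pickle r).+1.
  by rewrite Bq /= qr xr.
Qed.

End DensityChains.

Theorem theorem3p2 (R : realType) (T : set (set posnat))
    (TF : T `<=` has_nu R) (Tchain : chain T) :
  let S1 := Tstar T `<=` has_nu R /\ nu_sup_inf R T in
  let S2 := exists U : set (set posnat), dense_chain_extension R T U in
  let S3 := nu_uniform R T in
  ((S1 <-> S2) /\ (S2 <-> S3)) /\
  (S1 \/ S2 \/ S3 ->
   forall U : set (set posnat), dense_chain_extension R T U ->
     [/\ Tstar U `<=` has_nu R /\ nu_sup_inf R (Tstar U),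
         nu R @` Tstar U = `[0, 1]%classic &
         nu_uniform R (Tstar U)]).
Proof.
have S2S3 : (exists U, dense_chain_extension R T U) -> nu_uniform R T.
  move=> [U [Uc UF TU /nu_denseP Ud]].
  exact: nu_uniform_sub TU (dense_uniform UF Uc Ud).
have S3S1 : nu_uniform R T -> Tstar T `<=` has_nu R /\ nu_sup_inf R T.
  by move=> uT; have si := uniform_sup_inf TF Tchain uT; split=> //; exact: Tstar_has_nu.
have S1S2 : Tstar T `<=` has_nu R /\ nu_sup_inf R T ->
    exists U, dense_chain_extension R T U.
  move=> [_ si].
  have [U [TU UF Uc /nu_denseP Ud]] := gap_closed_dense (Tstar_gap_closed Tchain si TF).
  exists U; split => //; exact: subset_trans (@sub_Tstar T) TU.
split; first by split; split; auto.
move=> _ U [Uc UF _ /nu_denseP Ud].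
have Usi := uniform_sup_inf UF Uc (dense_uniform UF Uc Ud).
have VF := Tstar_has_nu Usi; have Vc := chain_Tstar Uc.
have Vu : nu_uniform R (Tstar U).
  apply: dense_uniform => // x y x0 xy y1.
  by have [A /sub_Tstar VA hA] := Ud x y x0 xy y1; exists A.
split => //; first by split => //; exact: uniform_sup_inf.
apply/seteqP; split=> [_ [A /VF hA <-]|x].
  by rewrite /= in_itv /=; exact: nu_itv.
rewrite /= in_itv /= => /andP[x0 x1].
pose C := [set A | U A /\ nu R A < x]; have CU : C `<=` U by move=> A [].
exists (\bigcup_(A in C) A); first by left; exists C.
have [[_ ->] _] := Usi _ CU.
have [|s0 sub slub] := @is_sup01_supremum R (nu R @` C).
  by move=> y [A /CU/UF/nu_itv hA <-].
apply/eqP; rewrite eq_le !leNgt; apply/andP; split; apply/negP.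
  move=> xs; have [|_ [A [_ +] <-]] := slub x; first by rewrite x0.
  by move=> /ltW; rewrite leNgt => /negP.
move=> sx; have [A UA /andP[sA Ax]] := Ud _ _ s0 sx x1.
by have := sub _ (imageP _ (conj UA Ax)); rewrite leNgt sA.
Qed.
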